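(* Let $(G,+,<)$ be an ordered abelian group, let $A\subseteq G^{>0}$ be a well ordered set of order type $\alpha\geq 2$, and let $\beta$ be the order type of the set of archimedean classes of elements of $A$. Then the set $\sum A$ of finite non-empty sums of elements of $A$ is well ordered of order type $\leq (\alpha^\omega)^{\odot\beta}$.
   Context: In an ordered abelian group, $a\preceq b$ means $|a|\leq n|b|$ for some $n\in\mathbb N$; $a,b$ are in the same archimedean class if $a\preceq b$ and $b\preceq a$; classes are ordered by their elements. $\oplus$ and $\odot$ denote the Hessenberg (natural) sum and product of ordinals. For an ordinal $\gamma$ and a sequence $(\alpha_i)$, $\bigodot_{i<0}\alpha_i=1$, $\bigodot_{i<\gamma+1}\alpha_i=(\bigodot_{i<\gamma}\alpha_i)\odot\alpha_\gamma$, and $\bigodot_{i<\lambda}\alpha_i=\sup_{\gamma<\lambda}\bigodot_{i<\gamma}\alpha_i$ for limit $\lambda$. Then $\delta^{\odot\beta}:=\bigodot_{i<\beta}\delta$. Ordinal exponentiation $\alpha^\omega$ is the usual one. *)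

(* Defs.v *)
From HB Require Import structures.
From mathcomp Require Import all_boot all_order all_algebra.
From mathcomp Require Import boolp classical_sets functions wochoice.

Set Implicit Arguments.
Unset Strict Implicit.
Unset Printing Implicit Defensive.

Import Order.TTheory GRing.Theory Num.Theory.

Local Open Scope classical_set_scope.
Local Open Scope order_scope.

(** [Tree X f] denotes the least ordinal strictly above all the [f i];
    ordinals are canonical representatives of trees up to [tle] in both
    directions, so that equality of ordinals is Leibniz equality. *)

Inductive tree : Type := Tree (X : Type) (f : X -> tree).

Fixpoint tle (s t : tree) : Prop :=
  match s, t with
  | Tree X f, Tree Y g => forall i, exists j, tle (f i) (g j)
  end.

Definition tlt (s t : tree) : Prop :=
  match t with Tree Y g => exists j, tle s (g j) end.

Lemma tle_refl s : tle s s.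
Proof. by elim: s => X f IH i; exists i; apply: IH. Qed.

Lemma tle_trans s t u : tle s t -> tle t u -> tle s u.
Proof.
elim: s t u => I f IH [J g] [K h] /= st tu i.
by have [j fg] := st i; have [k gh] := tu j; exists k; apply: IH fg gh.
Qed.

Lemma tle_or_tlt s t : tle s t \/ tlt t s.
Proof.
elim: s t => I f IH [J g]; have [|nst] := pselect (tle (Tree f) (Tree g)).
  by left.
right; have /existsNP[i /forallNP nfg] := nst; exists i.
case: (f i) (IH i) nfg => K h IHi nfg j.
by have [/nfg //|] := IHi (g j).
Qed.

Lemma tltNge s t : tlt s t -> ~ tle t s.
Proof.
elim: s t => I f IH [J g] [j sg] ts.
have [k gf] := ts j; apply: (IH k (g j)) gf.
case: (g j) sg => K h; exact.
Qed.

Definition teq (s t : tree) : Prop := tle s t /\ tle t s.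

Lemma tltW s t : tlt s t -> tle s t.
Proof.
elim: t s => Y g IH [X f] [j sg] i; exists j.
by apply: IH; case: (g j) sg => Z h /(_ i).
Qed.

HB.instance Definition _ := gen_eqMixin tree.
HB.instance Definition _ := gen_choiceMixin tree.

Definition tcanon (t : tree) : tree :=
  xget (Tree (of_void tree)) [set s | teq t s].

Lemma tcanonP t : teq t (tcanon t).
Proof.
by rewrite /tcanon; case: xgetP => // /(_ t)[]; split; apply: tle_refl.
Qed.

Lemma tcanon_eq s t : teq s t -> tcanon s = tcanon t.
Proof.
move=> [st ts]; rewrite /tcanon; congr xget.
by apply/seteqP; split=> u /= [h1 h2]; split; apply: tle_trans; eauto.
Qed.

Record ord : Type := Ord { ord_tree : tree; _ : tcanon ord_tree == ord_tree }.

HB.instance Definition _ := [isSub for ord_tree].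
HB.instance Definition _ := [Choice of ord by <:].

Fact mkord_subproof t : tcanon (tcanon t) == tcanon t.
Proof. by apply/eqP/esym/tcanon_eq/tcanonP. Qed.

Definition mkord (t : tree) : ord := Ord (mkord_subproof t).

Lemma teq_ord (x y : ord) : teq (ord_tree x) (ord_tree y) -> x = y.
Proof.
case: x y => [s hs] [t ht] /= /tcanon_eq.
by rewrite (eqP hs) (eqP ht) => E; apply: val_inj.
Qed.

Fact ord_display : Order.disp_t. Proof. exact. Qed.

Definition ord_le (x y : ord) : bool := `[< tle (ord_tree x) (ord_tree y) >].

Fact ord_le_refl : reflexive ord_le.
Proof. by move=> x; apply/asboolP/tle_refl. Qed.

Fact ord_le_anti : antisymmetric ord_le.
Proof. by move=> x y /andP[/asboolP ? /asboolP ?]; apply: teq_ord. Qed.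

Fact ord_le_trans : transitive ord_le.
Proof.
by move=> y x z /asboolP xy /asboolP yz; apply/asboolP; apply: tle_trans yz.
Qed.

Fact ord_le_total : total ord_le.
Proof.
move=> x y; apply/orP; have [xy|yx] := tle_or_tlt (ord_tree x) (ord_tree y).
  by left; apply/asboolP.
by right; apply/asboolP; apply: tltW.
Qed.

HB.instance Definition _ :=
  Order.Le_isPOrder.Build ord_display ord ord_le_refl ord_le_anti ord_le_trans.
HB.instance Definition _ := Order.POrder_isTotal.Build ord_display ord ord_le_total.

Lemma ord_leP (x y : ord) : reflect (tle (ord_tree x) (ord_tree y)) (x <= y).
Proof. exact: asboolP. Qed.

Lemma ord_ltP (x y : ord) : reflect (tlt (ord_tree x) (ord_tree y)) (x < y).
Proof.
rewrite ltNge; apply: (iffP negP) => [nyx|xy /ord_leP]; last exact: tltNge.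
by have [/ord_leP|] := tle_or_tlt (ord_tree y) (ord_tree x).
Qed.

Lemma ord_lt_wf : well_founded (fun x y : ord => x < y).
Proof.
suff H t x : tle (ord_tree x) t -> Acc (fun x y : ord => x < y) x.
  by move=> x; apply: (H (ord_tree x)); apply: tle_refl.
elim: t x => Y g IH x xt; constructor=> y /ord_ltP.
case: (ord_tree x) xt => X f fg [i yf]; have [j fgj] := fg i.
by apply: (IH j); apply: tle_trans fgj.
Qed.

Lemma ord_ind (P : ord -> Prop) :
  (forall x, (forall y, y < x -> P y) -> P x) -> forall x, P x.
Proof. by move=> IH; apply: (well_founded_ind ord_lt_wf). Qed.

Lemma ord_bound (X : Type) (f : X -> ord) : exists b, forall i, f i < b.
Proof.
exists (mkord (Tree (fun i => ord_tree (f i)))) => i; apply/ord_ltP => /=.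
have := (tcanonP (Tree (fun i => ord_tree (f i)))).1.
by case: (tcanon _) => Y g /(_ i).
Qed.

(** [omin P] is the least element of [P] when [P] is nonempty. *)
Definition omin (P : set ord) : ord :=
  xget (mkord (Tree (of_void tree))) [set x | P x /\ lbound P x].

Lemma ominP (P : set ord) : P !=set0 -> P (omin P) /\ lbound P (omin P).
Proof.
move=> [x Px]; rewrite /omin; case: xgetP => [_ -> //|no].
suff: ~ P x by []; elim/ord_ind: x {Px} => x IH Px; apply: (no x); split=> // y Py.
by rewrite leNgt; apply/negP => /IH; apply.
Qed.

(** The supremum of a set of ordinals (junk if the set is unbounded). *)
Definition osup (P : set ord) : ord := omin (ubound P).

Lemma osupP (P : set ord) : ubound P !=set0 ->
  ubound P (osup P) /\ lbound (ubound P) (osup P).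
Proof. exact: ominP. Qed.

Definition ozero : ord := omin setT.

Definition osucc (x : ord) : ord := omin [set y | x < y].

Fixpoint onat (n : nat) : ord := if n is n'.+1 then osucc (onat n') else ozero.

Definition oomega : ord := osup (range onat).

(** Transfinite recursion: [orec z s] is the function [F] with [F 0 = z],
    [F (x + 1) = s x (F x)] and [F l = sup_(x < l) F x] for [l] limit; see
    [orec0], [orecS] and [orec_lim]. *)
Definition orec (z : ord) (s : ord -> ord -> ord) : ord -> ord :=
  Fix ord_lt_wf (fun=> ord) (fun x F =>
    if x == ozero then z else
    if pselect (exists2 y, y < x & x = osucc y) is left h
    then s (s2val (cid2 h)) (F (s2val (cid2 h)) (s2valP (cid2 h)))
    else osup [set v | exists y (lt_yx : y < x), v = F y lt_yx]).

Definition olimit (x : ord) : Prop :=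
  x <> ozero /\ forall y, x <> osucc y.

Lemma ozero_le x : ozero <= x.
Proof. by have [_] := @ominP setT (ex_intro _ x I); apply. Qed.

Lemma osucc_gt x : x < osucc x.
Proof.
have [b hb] := ord_bound (fun _ : unit => x).
by have [] := @ominP [set y | x < y] (ex_intro _ b (hb tt)).
Qed.

Lemma osucc_le x y : (osucc x <= y) = (x < y).
Proof.
apply/idP/idP => [|xy]; first exact/lt_le_trans/osucc_gt.
by have [_] := @ominP [set y | x < y] (ex_intro _ y xy); apply.
Qed.

Lemma ltoS x y : (x < osucc y) = (x <= y).
Proof. by rewrite ltNge osucc_le -leNgt. Qed.

Lemma osucc_inj : injective osucc.
Proof.
move=> x y E; apply/eqP; rewrite eq_le -!ltoS -E osucc_gt.
by rewrite E osucc_gt.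
Qed.

Lemma olimit_ltS l x : olimit l -> x < l -> osucc x < l.
Proof.
by move=> [_ nS] xl; rewrite lt_neqAle osucc_le xl andbT eq_sym; apply/eqP/nS.
Qed.

Section Orec.
Variables (z : ord) (s : ord -> ord -> ord).

Let orecE x : orec z s x =
  if x == ozero then z else
  if pselect (exists2 y, y < x & x = osucc y) is left h
  then s (s2val (cid2 h)) (orec z s (s2val (cid2 h)))
  else osup [set v | exists y (_ : y < x), v = orec z s y].
Proof.
rewrite {1}/orec Fix_eq // => {}x F G FG.
by have -> : F = G by apply/functional_extensionality_dep => y; apply/funext.
Qed.

Lemma orec0 : orec z s ozero = z.
Proof. by rewrite orecE eqxx. Qed.

Lemma orecS x : orec z s (osucc x) = s x (orec z s x).
Proof.
rewrite orecE gt_eqF ?(le_lt_trans (ozero_le x) (osucc_gt x)) //.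
case: pselect => [h|[]]; last by exists x; rewrite ?osucc_gt.
by case: (cid2 h) => y /= _ /osucc_inj ->.
Qed.

Lemma orec_lim x : olimit x ->
  orec z s x = osup [set orec z s y | y in [set y | y < x]].
Proof.
move=> [x0 xS]; rewrite orecE; move/eqP/negPf: x0 => ->.
case: pselect => [[y _ /xS]//|_]; congr osup.
by apply/seteqP; split=> v /= [y]; [case=> yx ->|move=> yx <-]; exists y => //; exists yx.
Qed.

End Orec.

Lemma ord_case x : [\/ x = ozero, exists y, x = osucc y | olimit x].
Proof.
have [->|x0] := pselect (x = ozero); first by constructor 1.
have [?|/forallNP nS] := pselect (exists y, x = osucc y); first by constructor 2.
by constructor 3.
Qed.

Lemma ord_small x :
  exists (X : Type) (g : X -> ord), forall y, y < x -> exists i, g i = y.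
Proof.
elim/ord_ind: x => x IH; case E: (ord_tree x) => [X f].
have fx i : mkord (f i) < x.
  apply/ord_ltP; rewrite E; exists i; exact: (tcanonP (f i)).2.
have {IH}/choice[Y hY] i := IH _ (fx i).
have {hY}/choice[g hg] : forall i, exists g : {i & Y i} -> ord,
    forall y, y < mkord (f i) -> exists j, g (Tagged Y (j : Y i)) = y.
  move=> i; have [g hg] := hY i.
  exists (fun p => if pselect (tag p = i) is left e
                   then g (ecast i (Y i) e (tagged p)) else x) => y /hg[j <-].
  by exists j; case: pselect => //= e; rewrite (Prop_irrelevance e erefl).
exists (X * option {i & Y i})%type.
exists (fun p => if p.2 is Some q then g p.1 q else mkord (f p.1)) => y /ord_ltP.
rewrite E => -[i yf]; have : y <= mkord (f i).
  by apply/ord_leP; apply: tle_trans yf _; exact: (tcanonP (f i)).1.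
rewrite le_eqVlt => /predU1P[->|/hg[j <-]]; first by exists (i, None).
by exists (i, Some (Tagged Y j)).
Qed.

Lemma osup_image x (F : ord -> ord) :
  let u := osup [set F y | y in [set y | y < x]] in
  (forall y, y < x -> F y <= u) /\
  (forall b, (forall y, y < x -> F y <= b) -> u <= b).
Proof.
move=> u; have [X [g hg]] := ord_small x.
have [b hb] := ord_bound (F \o g).
have /osupP[h1 h2] : ubound [set F y | y in [set y | y < x]] !=set0.
  by exists b => _ [y /hg[i <-] <-]; apply/ltW/hb.
split=> [y yx|c hc]; first by apply: h1; exists y.
by apply: h2 => _ [y yx <-]; apply: hc.
Qed.

Lemma orec_lim_ge z s l x : olimit l -> x < l -> orec z s x <= orec z s l.
Proof. by move=> /orec_lim -> xl; apply: (osup_image l _).1. Qed.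

Lemma orec_lim_le z s l b : olimit l ->
  (forall x, x < l -> orec z s x <= b) -> orec z s l <= b.
Proof. by move=> /orec_lim -> xl; apply: (osup_image l _).2. Qed.

Section OrecMono.
Variables (z : ord) (s : ord -> ord -> ord).
Hypothesis s_gt : forall c v, z <= v -> v < s c v.

Let olimit_gt0 l : olimit l -> ozero < l.
Proof. by case=> l0 _; rewrite lt_neqAle ozero_le andbT eq_sym; apply/eqP. Qed.

Lemma orec_ge_base x : z <= orec z s x.
Proof.
elim/ord_ind: x => x IH; have [->|[y E]|xl] := ord_case x.
- by rewrite orec0.
- have zy : z <= orec z s y by apply: IH; rewrite E osucc_gt.
  by rewrite E orecS (le_trans zy) // ltW ?s_gt.
- by rewrite -{1}(orec0 z s) orec_lim_ge ?olimit_gt0.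
Qed.

Lemma orec_lt x y : x < y -> orec z s x < orec z s y.
Proof.
elim/ord_ind: y x => y IH x xy; have [E|[w E]|yl] := ord_case y.
- by move: xy; rewrite E ltNge ozero_le.
- move: xy; rewrite E ltoS orecS le_eqVlt => /predU1P[->|xw].
    exact/s_gt/orec_ge_base.
  apply: lt_trans (s_gt _ (orec_ge_base w)); apply: IH xw; rewrite E osucc_gt //.
- have xSy := olimit_ltS yl xy.
  by apply: lt_le_trans (orec_lim_ge _ _ yl xSy); rewrite orecS s_gt ?orec_ge_base.
Qed.

Lemma orec_leE x y : (orec z s x <= orec z s y) = (x <= y).
Proof. by apply: le_mono => a b; apply: orec_lt. Qed.

Lemma orec_ltE x y : (orec z s x < orec z s y) = (x < y).
Proof. by rewrite !ltNge orec_leE. Qed.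

Lemma orec_ge x : x <= orec z s x.
Proof.
elim/ord_ind: x => x IH; rewrite leNgt; apply/negP => h.
by have := IH _ h; rewrite leNgt orec_lt.
Qed.

End OrecMono.

Definition oadd (x : ord) : ord -> ord := orec x (fun _ v => osucc v).
Definition omul (x : ord) : ord -> ord := orec ozero (fun _ v => oadd v x).
Definition oexp (x : ord) : ord -> ord := orec (osucc ozero) (fun _ v => omul v x).

Local Lemma osucc_gt' x (_ v : ord) : x <= v -> v < osucc v.
Proof. by move=> _; apply: osucc_gt. Qed.

Lemma oadd0 x : oadd x ozero = x.
Proof. exact: orec0. Qed.

Lemma oaddS x y : oadd x (osucc y) = osucc (oadd x y).
Proof. exact: orecS. Qed.

Lemma oadd_leE x y z : (oadd x y <= oadd x z) = (y <= z).
Proof. exact/orec_leE/osucc_gt'. Qed.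

Lemma oadd_ltE x y z : (oadd x y < oadd x z) = (y < z).
Proof. exact/orec_ltE/osucc_gt'. Qed.

Lemma oadd_inj x : injective (oadd x).
Proof. by move=> y z E; apply/le_anti; rewrite -(oadd_leE x y z) -(oadd_leE x z y) E lexx. Qed.

Lemma oadd_limit x l : olimit l -> olimit (oadd x l).
Proof.
move=> ll; split=> [E|y E].
  have : ozero < l by rewrite lt_neqAle ozero_le andbT eq_sym; apply/eqP/ll.1.
  by rewrite -(oadd_ltE x) E ltNge ozero_le.
suff : oadd x l <= y by rewrite leNgt E osucc_gt.
apply: orec_lim_le => // w wl; rewrite -ltoS -E.
by rewrite -/(oadd x w) oadd_ltE.
Qed.

Lemma le_oaddl x y z : x <= y -> oadd x z <= oadd y z.
Proof.
move=> xy; elim/ord_ind: z => z IH; have [->|[w E]|zl] := ord_case z.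
- by rewrite !oadd0.
- by rewrite E !oaddS osucc_le ltoS IH // E osucc_gt.
- apply: orec_lim_le => // w wl; apply: le_trans (IH _ wl) _.
  by rewrite oadd_leE ltW.
Qed.

Lemma oadd0l x : oadd ozero x = x.
Proof.
elim/ord_ind: x => x IH; have [->|[w E]|xl] := ord_case x.
- by rewrite oadd0.
- by rewrite E oaddS IH // E osucc_gt.
- apply/le_anti; rewrite (orec_ge (@osucc_gt' _)) andbT.
  by apply: orec_lim_le => // w wx; rewrite -/(oadd _ _) IH // ltW.
Qed.

Lemma oadd_ger x y : y <= oadd x y.
Proof. by rewrite -{1}(oadd0l y) le_oaddl ?ozero_le. Qed.

Lemma oadd_gel x y : x <= oadd x y.
Proof. by rewrite -{1}(oadd0 x) oadd_leE ozero_le. Qed.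

Lemma osub_ex x y : x <= y -> exists z, oadd x z = y.
Proof.
move=> xy; have [h1 h2] := @ominP [set z | y <= oadd x z]
  (ex_intro _ y (oadd_ger x y)).
move: (omin _) h1 h2 => z /= yz zmin; exists z; apply/le_anti; rewrite yz andbT.
have lty w : w < z -> oadd x w < y.
  by rewrite !ltNge; apply: contra => /zmin.
have [->|[w E]|zl] := ord_case z; first by rewrite oadd0.
  by rewrite E oaddS osucc_le lty // E osucc_gt.
by apply: orec_lim_le => // w /lty/ltW.
Qed.

Lemma oaddA x y z : oadd x (oadd y z) = oadd (oadd x y) z.
Proof.
elim/ord_ind: z => z IH; have [->|[w E]|zl] := ord_case z.
- by rewrite !oadd0.
- by rewrite E !oaddS IH // E osucc_gt.
- apply/le_anti/andP; split.
    apply: orec_lim_le => [|w]; first exact: oadd_limit.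
    have [wy _|yw] := leP w y.
      by rewrite (le_trans _ (oadd_gel _ _)) // -/(oadd x w) oadd_leE.
    have [v <-] := osub_ex (ltW yw); rewrite oadd_ltE => vz.
    by rewrite -/(oadd x _) IH // oadd_leE ltW.
  by apply: orec_lim_le => // w wz; rewrite -/(oadd _ _) -IH // !oadd_leE ltW.
Qed.

Lemma omul0 x : omul x ozero = ozero.
Proof. exact: orec0. Qed.

Lemma omulS x y : omul x (osucc y) = oadd (omul x y) x.
Proof. exact: orecS. Qed.

Lemma omul_ltE x y z : ozero < x -> (omul x y < omul x z) = (y < z).
Proof. by move=> x0; apply: orec_ltE => _ v _; rewrite -{1}(oadd0 v) oadd_ltE. Qed.

Lemma omul1 x : omul x (osucc ozero) = x.
Proof. by rewrite omulS omul0 oadd0l. Qed.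

Lemma onat_lt m n : (m < n)%N -> onat m < onat n.
Proof.
elim: n => // n IH; rewrite ltnS leq_eqVlt => /predU1P[->|/IH h] /=.
  exact: osucc_gt.
exact/(lt_trans h)/osucc_gt.
Qed.

Lemma oomegaP : (forall n, onat n < oomega) /\
  (forall x, x < oomega -> exists n, x = onat n).
Proof.
have [b hb] := ord_bound onat.
have /osupP[h1 h2] : ubound (range onat) !=set0.
  by exists b => _ [n _ <-]; apply/ltW/hb.
have h n : onat n < oomega.
  by apply: lt_le_trans (osucc_gt _) _; apply: h1; exists n.+1.
split=> // x xw; have [n xn] : exists n, x <= onat n.
  apply: contrapT => /forallNP nx; move: xw; rewrite ltNge => /negP; apply.
  by apply: h2 => _ [n _ <-]; have /negP := nx n; rewrite -ltNge => /ltW.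
elim: n xn => [|n IH] /=.
  by move=> x0; exists 0%N; apply/le_anti; rewrite x0 ozero_le.
by rewrite le_eqVlt ltoS => /predU1P[->|/IH//]; exists n.+1.
Qed.

Lemma olimit_omega : olimit oomega.
Proof.
have [h1 h2] := oomegaP; split=> [E|x E]; first by have := h1 0%N; rewrite E ltxx.
have [n xn] : exists n, x = onat n by apply: h2; rewrite E osucc_gt.
by have := h1 n.+1; rewrite E xn ltxx.
Qed.

Lemma oexp_gt0 x y : osucc ozero < x -> ozero < oexp x y.
Proof.
move=> x1; rewrite -osucc_le; apply: orec_ge_base => _ v; rewrite osucc_le => v0.
by rewrite -{1}(omul1 v) omul_ltE.
Qed.

Lemma oexp_ltE x y z : osucc ozero < x -> (oexp x y < oexp x z) = (y < z).
Proof.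
move=> x1; apply: orec_ltE => _ v; rewrite osucc_le => v0.
by rewrite -{1}(omul1 v) omul_ltE.
Qed.

Lemma oexpS x y : oexp x (osucc y) = omul (oexp x y) x.
Proof. exact: orecS. Qed.

Local Notation "w^ e" := (oexp oomega e) (at level 5, format "w^ e").

Local Lemma lt1w : osucc ozero < oomega.
Proof. exact: (oomegaP.1 1%N). Qed.

Definition ocnf (l : seq ord) : ord := foldr (fun e v => oadd (w^ e) v) ozero l.

Definition is_cnf (x : ord) (l : seq ord) : Prop := sorted >=%O l /\ ocnf l = x.

Lemma is_cnf_ex x : exists l, is_cnf x l.
Proof.
elim/ord_ind: x => x IH; have [->|/eqP x0] := pselect (x = ozero).
  by exists [::].
have {x0} x0 : ozero < x by rewrite lt_neqAle ozero_le eq_sym x0.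
have xb : x < w^ (osucc x).
  apply: lt_le_trans (osucc_gt x) _; apply: orec_ge => _ v; rewrite osucc_le => v0.
  by rewrite -{1}(omul1 v) omul_ltE // lt1w.
have [h1 h2] := @ominP [set e | x < w^ e] (ex_intro [set e | x < w^ e] (osucc x) xb).
move: (omin _) h1 h2 => m /= xm mmin.
have lem e : e < m -> w^ e <= x.
  by move=> em; rewrite leNgt; apply/negP => /mmin; rewrite leNgt em.
have [E|[e E]|ml] := ord_case m.
- by move: xm; rewrite E /oexp orec0 ltNge osucc_le x0.
- have ex : w^ e <= x by apply: lem; rewrite E osucc_gt.
  have [r rx] := osub_ex ex; have rlex : r <= x by rewrite -rx oadd_ger.
  move: xm; rewrite E oexpS => xm.
  have r_lt : r < x.
    rewrite lt_neqAle rlex andbT; apply/eqP => rE; move: xm.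
    rewrite ltNge => /negP; apply; apply: orec_lim_le => [|_ /oomegaP.2[n ->]].
      exact: olimit_omega.
    rewrite -/(omul _ _).
    suff H : oadd (omul (w^ e) (onat n)) x = x by rewrite -[leRHS]H oadd_gel.
    elim: n => [|n IHn] /=; first by rewrite omul0 oadd0l.
    by rewrite omulS -oaddA -{1}rE rx.
  have [l [sl lr]] := IH _ r_lt; exists (e :: l); split; last by rewrite /= lr.
  case: l sl lr => //= h l sl lr; rewrite sl andbT /= -ltoS -(oexp_ltE _ _ lt1w) oexpS.
  by apply: le_lt_trans xm; apply: le_trans rlex; rewrite -lr oadd_gel.
- by have := orec_lim_le ml lem; rewrite leNgt xm.
Qed.

Lemma ocnf_lt e l : all (<= e) l -> ocnf l < w^ (osucc e).
Proof.
move=> le; rewrite oexpS.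
suff H : ocnf l <= omul (w^ e) (onat (size l)).
  by apply: le_lt_trans H _; rewrite omul_ltE ?oexp_gt0 ?(oomegaP.1) ?lt1w.
elim: l le => [_|h l IH /= /andP[he /IH {}IH]]; first by rewrite ozero_le.
have C n x : oadd x (omul x (onat n)) = omul x (onat n.+1).
  by elim: n => [|n IHn]; rewrite /= omulS ?omul0 ?oadd0 ?oadd0l // oaddA IHn omulS.
rewrite -[osucc (onat _)]/(onat (size l).+1) -C.
apply: le_trans (_ : oadd (w^ h) (omul (w^ e) (onat (size l))) <= _).
  by rewrite oadd_leE.
by apply: le_oaddl; rewrite leNgt oexp_ltE ?lt1w // -leNgt.
Qed.

Lemma is_cnf_uniq x l l' : is_cnf x l -> is_cnf x l' -> l = l'.
Proof.
have hd h t : sorted >=%O (h :: t) ->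
    w^ h <= ocnf (h :: t) /\ ocnf (h :: t) < w^ (osucc h).
  move=> st; split; first exact: oadd_gel.
  apply: ocnf_lt => /=; rewrite lexx /=; apply: order_path_min st.
  by move=> a b c /= ba ac; apply: le_trans ac ba.
elim: l l' x => [|h l IH] [|h' l'] x [sl El] [sl' El'] //.
- have := oexp_gt0 h' lt1w; rewrite ltNge => /negP[].
  by rewrite -[ozero]/(ocnf [::]) El -El'; apply: (hd _ _ sl').1.
- have := oexp_gt0 h lt1w; rewrite ltNge => /negP[].
  by rewrite -[ozero]/(ocnf [::]) El' -El; apply: (hd _ _ sl).1.
have [a b] := hd _ _ sl; have [a' b'] := hd _ _ sl'.
rewrite El in a b; rewrite El' in a' b'.
have E : h = h'.
  apply/le_anti; rewrite -!ltoS -(oexp_ltE h _ lt1w) -(oexp_ltE h' _ lt1w).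
  by rewrite (le_lt_trans a b') (le_lt_trans a' b).
move: El El' => <-; rewrite -E /= => /oadd_inj E'; congr (_ :: _).
by apply: (IH l' (ocnf l)); split; rewrite ?(path_sorted sl) ?(path_sorted sl').
Qed.

(** Exponents, in weakly decreasing order and with repetitions, of the Cantor
    normal form of [x]. *)
Definition cnf_exps (x : ord) : seq ord := xget [::] (is_cnf x).

Lemma cnf_expsP x : is_cnf x (cnf_exps x).
Proof. by rewrite /cnf_exps; case: xgetP => // n; have [l /n] := is_cnf_ex x. Qed.

Definition hsum (x y : ord) : ord :=
  ocnf (sort >=%O (cnf_exps x ++ cnf_exps y)).

Definition hprod (x y : ord) : ord :=
  ocnf (sort >=%O [seq hsum e f | e <- cnf_exps x, f <- cnf_exps y]).

Definition bighprod (a : ord -> ord) : ord -> ord :=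
  orec (osucc ozero) (fun i v => hprod v (a i)).

Definition hexp (d b : ord) : ord := bighprod (fun=> d) b.

Section OrderType.
Variables (T : Type) (R : rel T).

Definition is_otype (A : set T) (o : ord) : Prop :=
  exists f : T -> ord, set_bij A [set p | p < o] f /\
    {in A &, {mono f : x y / R x y >-> x <= y}}.

(** The order type of [A] for [R] (junk if [A] is not well ordered). *)
Definition otype (A : set T) : ord := xget ozero (is_otype A).

End OrderType.

Lemma is_otype_uniq (T : Type) (R : rel T) (A : set T) o o' :
  is_otype R A o -> is_otype R A o' -> o = o'.
Proof.
suff H p q : is_otype R A p -> is_otype R A q -> p <= q.
  by move=> h h'; apply/le_anti; rewrite !H.
move=> [f [[fp f_inj f_surj] f_mono]] [g [[gq g_inj g_surj] g_mono]].
suff H x : A x -> f x <= g x.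
  rewrite leNgt; apply/negP => qp; have [x Ax fx] := f_surj q qp.
  by have := H x Ax; rewrite fx leNgt => /negP; apply; apply: gq.
move Ep : (f x) => v; elim/ord_ind: v x Ep => v IH x Ep Ax.
rewrite leNgt; apply/negP => gv.
have vp : v < p by rewrite -Ep; apply: fp.
have [y Ay fy] := f_surj (g x) (lt_trans gv vp).
have gyx : g y < g x.
  by rewrite ltNge g_mono ?inE // -f_mono ?inE // Ep fy -ltNge.
by have := IH _ gv y fy Ay; rewrite leNgt gyx.
Qed.

Lemma otypeP (T : Type) (R : rel T) (A : set T) :
  wo_chain R [in A] -> is_otype R A (otype R A).
Proof.
move=> wo; suff [o Ao] : exists o, is_otype R A o.
  by rewrite /otype; case: xgetP => // /(_ o).
pose T' : eqType := HB.pack T (gen_eqMixin T).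
have tot := @wo_chainW T' R _ wo; have anti := @wo_chain_antisymmetric T' R _ wo.
have refl := @wo_chain_reflexive T' R _ wo.
have least (B : set T) : B `<=` A -> B !=set0 -> exists x, B x /\ forall y, B y -> R x y.
  move=> BA [b Bb]; have [||x [[Bx lx] _]] := wo [in B].
  - by move=> y; rewrite !inE; apply: BA.
  - by exists b; rewrite inE.
  - by exists x; split; [move: Bx; rewrite inE|move=> y By; apply: lx; rewrite inE].
pose lt x y := [/\ A x, A y, R x y & x <> y].
have ltNR x y : A x -> A y -> ~ R x y -> lt y x.
  move=> Ax Ay nR; split=> //; last by move=> E; apply: nR; rewrite E refl ?inE.
  by have := tot x y; rewrite !inE => /(_ Ax Ay)/orP[/nR|].
have wf : well_founded lt.
  move=> x; apply: contrapT => nx.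
  have Ax : A x by apply: contrapT => nA; apply: nx; constructor=> y [].
  have [||z [[Az nz] zmin]] := least (A `&` [set y | ~ Acc lt y]).
  - by move=> y [].
  - by exists x.
  - apply: nz; constructor=> y [Ay _ Ryz ne]; apply: contrapT => ny.
    by apply: ne; apply: anti; rewrite ?inE // Ryz zmin.
pose rk := Fix wf (fun=> ord)
  (fun x F => omin [set o | forall y (h : lt y x), F y h < o]).
have rkE x : rk x = omin [set o | forall y, lt y x -> rk y < o].
  rewrite {1}/rk Fix_eq // => {}x F G FG.
  by have -> : F = G by apply/functional_extensionality_dep => y; apply/funext.
have rkP x : (forall y, lt y x -> rk y < rk x) /\
    (forall o, (forall y, lt y x -> rk y < o) -> rk x <= o).
  have [b hb] := ord_bound rk; rewrite rkE.
  have [h1 h2] := @ominP [set o | forall y, lt y x -> rk y < o]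
     (ex_intro _ b (fun y _ => hb y)).
  by split.
have rk_mono : {in A &, {mono rk : x y / R x y >-> x <= y}}.
  move=> x y; rewrite !inE => Ax Ay; apply/idP/idP => [h|Rxy].
    by apply: contrapT => /(ltNR _ _ Ax Ay)/(rkP x).1; rewrite ltNge h.
  have [->//|ne] := pselect (x = y); apply/ltW/(rkP y).1; by split.
have [b hb] := ord_bound rk.
have [h1 h2] := @ominP [set o | forall x, A x -> rk x < o]
  (ex_intro _ b (fun y _ => hb y)).
exists (omin [set o | forall x, A x -> rk x < o]); exists rk; split=> //; split.
- by move=> x /= /h1.
- move=> x y Ax Ay E; apply: anti => //; rewrite -!rk_mono // E lexx //.
- move=> p /= po.
  have [x [Ax px]] : exists x, A x /\ p <= rk x.
    apply: contrapT => no; move: po; rewrite ltNge => /negP; apply; apply: h2 => x Ax.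
    by rewrite ltNge; apply/negP => px; apply: no; exists x.
  have [||z [[Az pz] zmin]] := least (A `&` [set y | p <= rk y]).
  - by move=> y [].
  - by exists x.
  - exists z => //; apply/le_anti; rewrite [p <= _]pz andbT.
    apply: (rkP z).2 => y [Ay _ Ryz ne]; rewrite ltNge; apply/negP => py.
    by apply: ne; apply: anti; rewrite ?inE // Ryz zmin.
Qed.

HB.mixin Record isOrderedGroup G of Num.POrderedZmodule G := {
  oag_le_total : total (<=%R : rel G);
  oag_leD2r : forall z x y : G, (x <= y)%R -> (x + z <= y + z)%R
}.

#[short(type="oagType")]
HB.structure Definition OrderedGroup :=
  {G of Num.POrderedZmodule G & isOrderedGroup G}.

Section Archimedean.
Local Open Scope ring_scope.
Variable G : oagType.
Implicit Types (a b : G) (A : set G).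

Definition oag_abs a : G := Order.max a (- a).

Definition arch_le a b : Prop := exists n : nat, oag_abs a <= oag_abs b *+ n.

(** Typed [G -> Prop] rather than [set G]: the universe of [set], which also
    bounds [ord], is too large for [otypeP]. *)
Definition arch_class a : G -> Prop := [set b | arch_le a b /\ arch_le b a].

Definition arch_class_le : rel (G -> Prop) :=
  fun C D => `[< exists a b, [/\ C a, D b & arch_le a b] >].

Definition finite_sums A : set G :=
  [set x | exists s : seq G,
     [/\ s <> [::], (forall a, a \in s -> A a) & x = \sum_(a <- s) a]].

End Archimedean.

(** Well ordered subsets of an ordered group have genuine order types: the
    carrier lives in a universe small enough for [otypeP] to apply. *)
Lemma oag_otypeP (G : oagType) (A : set G) :
  wo_chain (T := G) <=%R [in A] -> is_otype (T := G) <=%R A (otype (T := G) <=%R A).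
Proof. exact: otypeP. Qed.

Lemma oag_arch_otypeP (G : oagType) (A : set (G -> Prop)) :
  wo_chain (@arch_class_le G) [in A] ->
  is_otype (@arch_class_le G) A (otype (@arch_class_le G) A).
Proof. exact: otypeP. Qed.

(* Main.v *)
(** Embed [sum A] strictly increasingly into the bound, by induction on the
    number [beta] of archimedean classes.  Adding a largest class writes [sum A]
    inside a sumset [S + T], and sumsets multiply order types naturally: splitting
    both types along their Cantor normal forms reduces this to powers of omega,
    where the part of [S + T] below [s + t] lies in the union of [S_{<s} + T] and
    [S + T_{<t}], whose types are smaller by induction, and powers of omega are
    closed under natural sums.  For a single class with least element [a], the sums
    up to [n a] have at most [n] terms, so they have type at most the natural power
    [(alpha + 1)^n], which is at most [alpha^omega].  At limit stages the sums over
    fewer classes form initial segments. *)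

Require Import Defs.
From mathcomp Require Import all_boot all_order all_algebra.
From mathcomp Require Import boolp classical_sets functions wochoice.

Import Order.TTheory GRing.Theory.

Local Open Scope classical_set_scope.
Local Open Scope ring_scope.

Section Ordinals.
Local Open Scope order_scope.
Implicit Types (x y z e f : ord) (l : seq ord).

Local Notation "w^ e" := (oexp oomega e) (at level 5, format "w^ e").

(** * Powers of omega *)

Lemma one_lt_omega : osucc ozero < oomega.
Proof. exact: (oomegaP.1 1%N). Qed.

Lemma omega_exp_le e f : (w^ e <= w^ f) = (e <= f).
Proof. by rewrite !leNgt oexp_ltE // one_lt_omega. Qed.

Lemma omega_exp0 : w^ ozero = osucc ozero.
Proof. exact: orec0. Qed.

Lemma omega_exp_succ0 : w^ (osucc ozero) = oomega.
Proof.
rewrite oexpS omega_exp0; apply/le_anti/andP; split; last first.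
  by apply: orec_ge => _ v _; rewrite -{1}(oadd0 v) oadd_ltE osucc_gt.
apply: orec_lim_le => [|_ /oomegaP.2[n ->]]; first exact: olimit_omega.
apply: ltW; rewrite -/(omul _ _).
suff -> : omul (osucc ozero) (onat n) = onat n by apply: oomegaP.1.
by elim: n => [|n IH] /=; rewrite ?omul0 // omulS IH oaddS oadd0.
Qed.

(** * Cantor normal forms and the Hessenberg operations *)

Lemma ge_ord_total : total (>=%O : rel ord).
Proof. by move=> x y; rewrite orbC; apply: le_total. Qed.

Lemma ge_ord_trans : transitive (>=%O : rel ord).
Proof. by move=> y x z yx zy; apply: le_trans zy yx. Qed.

Lemma ge_ord_anti : antisymmetric (>=%O : rel ord).
Proof. by move=> x y; rewrite andbC; apply: le_anti. Qed.

Lemma cnf_exps_ocnf l : sorted >=%O l -> cnf_exps (ocnf l) = l.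
Proof. by move=> sl; apply: is_cnf_uniq (cnf_expsP _) _. Qed.

Lemma cnf_exps_sorted x : sorted >=%O (cnf_exps x).
Proof. exact: (cnf_expsP x).1. Qed.

Lemma cnf_expsK x : ocnf (cnf_exps x) = x.
Proof. exact: (cnf_expsP x).2. Qed.

Lemma cnf_exps_sort l : perm_eq (cnf_exps (ocnf (sort >=%O l))) l.
Proof. by rewrite cnf_exps_ocnf ?perm_sort // sort_sorted //; apply: ge_ord_total. Qed.

Lemma cnf_exps_inj x y : perm_eq (cnf_exps x) (cnf_exps y) -> x = y.
Proof.
move=> xy; rewrite -(cnf_expsK x) -(cnf_expsK y); congr ocnf.
exact: (sorted_eq ge_ord_trans ge_ord_anti (cnf_exps_sorted x) (cnf_exps_sorted y)).
Qed.

Lemma cnf_exps_hsum x y : perm_eq (cnf_exps (hsum x y)) (cnf_exps x ++ cnf_exps y).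
Proof. exact: cnf_exps_sort. Qed.

Lemma cnf_exps_hprod x y : perm_eq (cnf_exps (hprod x y))
  [seq hsum e f | e <- cnf_exps x, f <- cnf_exps y].
Proof. exact: cnf_exps_sort. Qed.

Lemma cnf_exps0 : cnf_exps ozero = [::].
Proof. exact: (@cnf_exps_ocnf [::]). Qed.

Lemma cnf_exps_omega_exp e : cnf_exps (w^ e) = [:: e].
Proof. by rewrite -{1}(oadd0 (w^ e)) (@cnf_exps_ocnf [:: e]). Qed.

Lemma sorted_head_max e l : sorted >=%O (e :: l) -> all (<= e) (e :: l).
Proof. by move=> sl; rewrite /= lexx; apply: order_path_min sl; exact: ge_ord_trans. Qed.

Lemma hsumC x y : hsum x y = hsum y x.
Proof.
apply: cnf_exps_inj; rewrite (permPl (cnf_exps_hsum _ _)).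
by rewrite (permPr (cnf_exps_hsum _ _)) perm_catC.
Qed.

Lemma hsum0 x : hsum x ozero = x.
Proof. by apply: cnf_exps_inj; rewrite (permPl (cnf_exps_hsum _ _)) cnf_exps0 cats0. Qed.

Lemma hprod_comm x y : hprod x y = hprod y x.
Proof.
apply: cnf_exps_inj; rewrite (permPl (cnf_exps_hprod _ _)).
rewrite (permPr (cnf_exps_hprod _ _)).
elim: (cnf_exps x) => [|e l IH]; first by rewrite allpairs0r.
rewrite allpairs_cons perm_sym (perm_allpairs_consr hsum _ (fun=> e) (fun=> l)).
by rewrite perm_cat // 1?perm_sym //; apply/permP => p; congr count; apply: eq_map => t; apply: hsumC.
Qed.

Lemma hprod_hsuml x y z : hprod (hsum x y) z = hsum (hprod x z) (hprod y z).
Proof.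
apply: cnf_exps_inj; rewrite (permPl (cnf_exps_hprod _ _)).
rewrite (permPr (cnf_exps_hsum _ _)).
rewrite (permPl (perm_allpairs _ (cnf_exps_hsum _ _) (perm_refl _))) allpairs_cat.
by apply: perm_cat; rewrite perm_sym cnf_exps_hprod.
Qed.

(* Multiplicities of exponents linearise [hsum], and compare two ordinals at
   the largest exponent where they differ. *)
Definition cnf_lt l l' := exists2 e,
  (count_mem e l < count_mem e l')%N &
  forall t, e < t -> (count_mem t l <= count_mem t l')%N.

Lemma cnf_lt_asym l l' : cnf_lt l l' -> ~ cnf_lt l' l.
Proof.
move=> [e he ht] [e' he' ht']; have [lt_ee'|lt_e'e|E] := ltgtP e e'.
- by have := ht _ lt_ee'; rewrite leqNgt he'.
- by have := ht' _ lt_e'e; rewrite leqNgt he.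
- by move: he'; rewrite -E ltnNge ltnW.
Qed.

Lemma count_above e t l : all (<= e) l -> e < t -> count_mem t l = 0%N.
Proof.
move=> le et; apply/count_memPn/negP => /(allP le) /=.
by rewrite leNgt et.
Qed.

Lemma ocnf_lt_cnf_lt l l' : sorted >=%O l -> sorted >=%O l' ->
  ocnf l < ocnf l' -> cnf_lt l l'.
Proof.
elim: l l' => [|h l IH] [|h' l'] sl sl'.
- by rewrite ltxx.
- by exists h' => //=; rewrite eqxx.
- by move=> h1; have := ozero_le (ocnf (h :: l)); rewrite leNgt h1.
have [hh'|h'h|E] := ltgtP h h'.
- have max t : h < t -> count_mem t (h :: l) = 0%N.
    exact/count_above/sorted_head_max.
  by exists h' => [|t h't]; rewrite max // ?(lt_trans hh') //= eqxx.
(* [w^ h] exceeds every sum of powers with exponents at most [h' < h], so this case contradicts the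
   assumed inequality. *)
- rewrite ltNge => /negP[]; apply/ltW.
  apply: lt_le_trans (ocnf_lt (sorted_head_max _ _ sl')) _.
  by apply: le_trans (oadd_gel _ _); rewrite omega_exp_le osucc_le.
- rewrite -E /= oadd_ltE => /(IH _ (path_sorted sl) (path_sorted sl'))[e he ht].
  by exists e => [|t et]; rewrite /= ?ltn_add2l ?leq_add2l // ht.
Qed.

(** The converse follows from the forward direction, since ordinals are linearly ordered and
    [cnf_lt] is asymmetric. *)
Lemma ord_lt_cnf x y : x < y <-> cnf_lt (cnf_exps x) (cnf_exps y).
Proof.
have H a b : a < b -> cnf_lt (cnf_exps a) (cnf_exps b).
  by move=> ab; apply: ocnf_lt_cnf_lt; rewrite ?cnf_exps_sorted ?cnf_expsK.
split=> [|xy]; first exact: H.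
rewrite ltNge; apply/negP; rewrite le_eqVlt => /predU1P[E|/H].
  by case: xy => e; rewrite E ltnn.
exact: cnf_lt_asym.
Qed.

Lemma hsum_ltl x y z : x < y -> hsum x z < hsum y z.
Proof.
move=> /ord_lt_cnf[e he ht]; apply/ord_lt_cnf; exists e => [|t et].
  by rewrite !(permP (cnf_exps_hsum _ _)) !count_cat ltn_add2r.
by rewrite !(permP (cnf_exps_hsum _ _)) !count_cat leq_add2r ht.
Qed.

Lemma hsum_ltr x y z : x < y -> hsum z x < hsum z y.
Proof. by rewrite ![hsum z _]hsumC; apply: hsum_ltl. Qed.

Lemma hsum_le x x' y y' : x <= x' -> y <= y' -> hsum x y <= hsum x' y'.
Proof.
move=> xx' yy'; apply: (@le_trans _ _ (hsum x' y)).
  by move: xx'; rewrite le_eqVlt => /predU1P[->//|/hsum_ltl/ltW].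
by move: yy'; rewrite le_eqVlt => /predU1P[->//|/hsum_ltr/ltW].
Qed.

(** Turns a bound by a power of omega into a condition on each exponent separately, which passes
    through concatenation and reordering. *)
Lemma lt_omega_exp x e : x < w^ e <-> all (< e) (cnf_exps x).
Proof.
split=> [xe|].
  have := cnf_expsK x; case E: (cnf_exps x) (cnf_exps_sorted x) => [//|h l] sl Ex.
  have he : h < e.
    rewrite ltNge; apply/negP; rewrite -omega_exp_le leNgt => /negP; apply.
    by apply: le_lt_trans xe; rewrite -Ex oadd_gel.
  by apply/allP => t /(allP (sorted_head_max _ _ sl)) th; apply: le_lt_trans he.
move=> /allP xe; apply/ord_lt_cnf; exists e.
  rewrite cnf_exps_omega_exp /= eqxx addn0 ltnS leqn0; apply/eqP/count_memPn.
  by apply/negP => /xe /=; rewrite ltxx.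
move=> t et; rewrite (_ : count_mem t _ = 0%N) //.
by apply/count_memPn/negP => /xe /=; rewrite ltNge ltW.
Qed.

Lemma lt_omega_exp_succ x e : x < w^ (osucc e) <-> all (<= e) (cnf_exps x).
Proof. by rewrite lt_omega_exp (eq_all (fun t => ltoS t e)). Qed.

Lemma hsum_lt_omega_exp x y e : x < w^ e -> y < w^ e -> hsum x y < w^ e.
Proof.
move=> /lt_omega_exp xe /lt_omega_exp ye; apply/lt_omega_exp.
by rewrite (perm_all _ (cnf_exps_hsum x y)) all_cat xe.
Qed.

Lemma hprod_omega_exp e f : hprod (w^ e) (w^ f) = w^ (hsum e f).
Proof.
apply: cnf_exps_inj; rewrite (permPl (cnf_exps_hprod _ _)).
by rewrite !cnf_exps_omega_exp.
Qed.

(** Multiplying by [w^ f] replaces each exponent [t] by [hsum t f], and [hsum] is strictly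
    monotone. *)
Lemma hprod_lt_omega_exp x e f : x < w^ e -> hprod x (w^ f) < w^ (hsum e f).
Proof.
move=> /lt_omega_exp/allP xe; apply/lt_omega_exp.
rewrite (perm_all _ (cnf_exps_hprod _ _)) cnf_exps_omega_exp.
apply/allP => v /allpairsP[[t t'] /= [/xe /= te]].
by rewrite inE => /eqP -> ->; apply: hsum_ltl.
Qed.

(* An ordinal that is not a power of omega splits as a natural sum of two
   smaller ordinals, which is also their ordinal sum. *)
Lemma ord_split x : [\/ x = ozero, exists e, x = w^ e |
  exists y z, [/\ y < x, z < x, oadd y z = x & hsum y z = x]].
Proof.
case E: (cnf_exps x) (cnf_exps_sorted x) => [|h [|h' l]] sl.
- by constructor 1; rewrite -(cnf_expsK x) E.
- by constructor 2; exists h; rewrite -(cnf_expsK x) E /= oadd0.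
constructor 3; exists (w^ h), (ocnf (h' :: l)).
have El := cnf_exps_ocnf _ (path_sorted sl : sorted >=%O (h' :: l)).
have Ex : hsum (w^ h) (ocnf (h' :: l)) = x.
  apply: cnf_exps_inj; rewrite (permPl (cnf_exps_hsum _ _)).
  by rewrite El E cnf_exps_omega_exp.
have l0 : ozero < ocnf (h' :: l).
  apply: lt_le_trans (oadd_gel _ _); exact/oexp_gt0/one_lt_omega.
have h0 : ozero < w^ h by exact/oexp_gt0/one_lt_omega.
split=> //; last by rewrite -[RHS]cnf_expsK E.
- by rewrite -[X in _ < X]Ex -{1}(hsum0 (w^ h)) hsum_ltr.
- by rewrite -[X in _ < X]Ex hsumC -[X in X < _]hsum0 hsum_ltr.
Qed.

(** * Inequalities for ordinary ordinal products and powers *)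

Lemma le_omulr x y z : ozero < x -> y <= z -> omul x y <= omul x z.
Proof. by move=> x0 yz; rewrite leNgt omul_ltE // -leNgt. Qed.

Lemma le_omull x y z : x <= y -> omul x z <= omul y z.
Proof.
move=> xy; have [x0|] := ltP ozero x; last first.
  move=> x0; have {x0 xy} -> : x = ozero by apply/le_anti; rewrite x0 ozero_le.
  suff -> : omul ozero z = ozero by apply: ozero_le.
  elim/ord_ind: z => z IH; have [->|[w E]|zl] := ord_case z.
  - by rewrite omul0.
  - by rewrite E omulS oadd0 IH // E osucc_gt.
  - apply/le_anti; rewrite ozero_le andbT.
    by apply: orec_lim_le => // w wz; rewrite -/(omul _ _) IH.
elim/ord_ind: z => z IH; have [->|[w E]|zl] := ord_case z.
- by rewrite !omul0.
- rewrite E !omulS; apply: le_trans (le_oaddl _ (_ : omul x w <= omul y w)) _.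
    by apply: IH; rewrite E osucc_gt.
  by rewrite oadd_leE.
- apply: orec_lim_le => // w wz; apply: le_trans (IH _ wz) _.
  by apply: le_omulr; [apply: lt_le_trans xy|apply: ltW].
Qed.

Lemma orec_lim_lt z0 s (u : ord) y : olimit u -> y < orec z0 s u ->
  exists2 w, w < u & y < orec z0 s w.
Proof.
move=> ul yu; apply: contrapT => no; move: yu; rewrite ltNge => /negP; apply.
apply: orec_lim_le => // w wu; rewrite leNgt; apply/negP => yw; apply: no.
by exists w.
Qed.

Lemma le_omulDr x y z : ozero < x -> oadd (omul x y) (omul x z) <= omul x (oadd y z).
Proof.
move=> x0; elim/ord_ind: z => z IH; have [->|[w E]|zl] := ord_case z.
- by rewrite omul0 !oadd0.
- by rewrite E oaddS !omulS oaddA le_oaddl // IH // E osucc_gt.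
(* Otherwise [x(y+z) = xy + p] with [p < xz], hence [p < xw] for some [w < z]. Then
   [xy + p < xy + xw <= x(y+w) <= x(y+z)], a contradiction. *)
- rewrite leNgt; apply/negP => lt.
  have [|p pE] := osub_ex (_ : omul x y <= omul x (oadd y z)).
    by rewrite le_omulr // oadd_gel.
  move: lt; rewrite -pE oadd_ltE => /(orec_lim_lt _ _ _ _ zl)[w wz].
  rewrite -/(omul x w) -(oadd_ltE (omul x y)) pE ltNge => /negP; apply.
  apply: le_trans (IH _ wz) _; apply: le_omulr => //.
  by rewrite oadd_leE ltW.
Qed.

(** The case of associativity used by the successor step of [le_omega_expD]; at finite stages it
    iterates [le_omulDr]. *)
Lemma le_omul_omegaA x y : ozero < x -> ozero < y ->
  omul (omul x y) oomega <= omul x (omul y oomega).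
Proof.
move=> x0 y0; apply: orec_lim_le => [|_ /oomegaP.2[n ->]]; first exact: olimit_omega.
rewrite -/(omul _ _); apply: (@le_trans _ _ (omul x (omul y (onat n)))).
  elim: n => [|n IH] /=; first by rewrite !omul0 ozero_le.
  rewrite !omulS; apply: le_trans (le_omulDr _ _ _ x0).
  exact: le_oaddl.
by rewrite le_omulr // le_omulr // ltW // oomegaP.1.
Qed.

Lemma le_omega_expD e f : w^ (oadd e f) <= omul (w^ e) (w^ f).
Proof.
have w0 t : ozero < w^ t by exact/oexp_gt0/one_lt_omega.
elim/ord_ind: f => f IH; have [->|[t E]|fl] := ord_case f.
- by rewrite oadd0 omega_exp0 omul1.
- rewrite E oaddS !oexpS; apply: le_trans (le_omul_omegaA _ _ _ _) => //.
  by apply: le_omull; apply: IH; rewrite E osucc_gt.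
(* An exponent [t] below [oadd e f] is at most [e] or has the form [oadd e u] with [u < f]. *)
- apply: orec_lim_le => [|t]; first exact: oadd_limit.
  rewrite -/(oexp oomega t) => tef; have [te|et] := leP t e.
    apply: (@le_trans _ _ (w^ e)); first by rewrite omega_exp_le.
    by rewrite -{1}(omul1 (w^ e)) le_omulr // osucc_le.
  have [u E] := osub_ex (ltW et); move: tef; rewrite -E oadd_ltE => uf.
  apply: le_trans (IH _ uf) _; apply: le_omulr => //.
  by rewrite omega_exp_le ltW.
Qed.

Lemma omega_exp_mul_le e x n : ozero < x -> w^ e <= x ->
  w^ (omul e (onat n)) <= oexp x (onat n).
Proof.
move=> x0 ex; elim: n => [|n IH] /=.
  by rewrite omul0 omega_exp0 /oexp orec0.
rewrite omulS oexpS; apply: le_trans (le_omega_expD _ _) _.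
apply: le_trans (le_omull _ _ _ IH) _; apply: le_omulr => //.
by apply: lt_le_trans IH; exact/oexp_gt0/one_lt_omega.
Qed.

Lemma ocnf_le_mul e l : all (<= e) l -> ocnf l <= omul (w^ e) (onat (size l)).
Proof.
have C n x : oadd x (omul x (onat n)) = omul x (onat n.+1).
  by elim: n => [|n IHn]; rewrite /= omulS ?omul0 ?oadd0 ?oadd0l // oaddA IHn omulS.
elim: l => [_|h l IH /= /andP[he /IH {}IH]]; first by rewrite ozero_le.
rewrite -[osucc (onat _)]/(onat (size l).+1) -C.
apply: (@le_trans _ _ (oadd (w^ h) (omul (w^ e) (onat (size l))))).
  by rewrite oadd_leE.
by apply: le_oaddl; rewrite omega_exp_le.
Qed.

(** * Finite natural multiples and powers, compared with [alpha^omega] *)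

Definition hmuln e k := iter k (hsum e) ozero.
Definition hexpn x k := iter k (hprod x) (osucc ozero).

(** No exponent of the natural multiple exceeds the leading exponent [f] of [e]. With [N] terms it
    is thus at most [w^ f] times [N], hence at most [e] times [N]; taking [N + 1] makes this
    strict. *)
Lemma hmuln_lt e k : ozero < e -> exists n, hmuln e k < omul e (onat n).
Proof.
move=> e0; have := cnf_expsK e.
case E: (cnf_exps e) (cnf_exps_sorted e) => [|f l] sl Ee.
  by move: e0; rewrite -Ee ltxx.
have fe : w^ f <= e by rewrite -Ee oadd_gel.
have le : all (<= f) (cnf_exps (hmuln e k)).
  elim: k => [|k IH]; first by rewrite cnf_exps0.
  by rewrite (perm_all _ (cnf_exps_hsum _ _)) all_cat IH E (sorted_head_max _ _ sl).
exists (size (cnf_exps (hmuln e k))).+1; rewrite -{1}(cnf_expsK (hmuln e k)).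
apply: le_lt_trans (ocnf_le_mul _ _ le) _.
apply: le_lt_trans (le_omull _ _ _ fe) _.
by rewrite omul_ltE // osucc_gt.
Qed.

(** Each exponent of the natural power is a natural sum of [k] exponents of [x]. *)
Lemma hexpn_lt x e k : all (<= e) (cnf_exps x) -> hexpn x k < w^ (osucc (hmuln e k)).
Proof.
move=> xe; apply/lt_omega_exp_succ; elim: k => [|k IH].
  by rewrite /= -omega_exp0 cnf_exps_omega_exp /= lexx.
rewrite (perm_all _ (cnf_exps_hprod _ _)); apply/allP => v /allpairsP[[t t'] /= []].
by move=> /(allP xe) te /(allP IH) te' ->; apply: hsum_le.
Qed.

(** The leading exponent [e] of [x] also bounds the exponents of [x + 1]. If [e > 0], the natural
    power lies below some [w^ (e n)], hence below the ordinary power [x^n]. *)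
Lemma hexpn_le_oexp x k : onat 2 <= x -> hexpn (hsum x (osucc ozero)) k <= oexp x oomega.
Proof.
move=> x2; have x1 : osucc ozero < x by rewrite -osucc_le.
have x0 : ozero < x by apply: lt_trans x1; apply: osucc_gt.
have := cnf_expsK x; case E: (cnf_exps x) (cnf_exps_sorted x) => [|e l] sl Ex.
  by move: x0; rewrite -Ex ltxx.
have ex : w^ e <= x by rewrite -Ex oadd_gel.
have le : all (<= e) (cnf_exps (hsum x (osucc ozero))).
  rewrite (perm_all _ (cnf_exps_hsum _ _)) all_cat E (sorted_head_max _ _ sl).
  by rewrite -omega_exp0 cnf_exps_omega_exp /= ozero_le.
apply/ltW; apply: lt_le_trans (hexpn_lt _ _ k le) _.
have [e0|e0] := ltP ozero e.
  have [n en] := hmuln_lt e k e0.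
  apply: (@le_trans _ _ (w^ (omul e (onat n)))); first by rewrite omega_exp_le osucc_le.
  apply: le_trans (omega_exp_mul_le _ _ n x0 ex) _; apply/ltW.
  by rewrite oexp_ltE // oomegaP.1.
(* Here [x] is finite: the bound on the natural power is [oomega], which is at most [x^omega]. *)
have -> : hmuln e k = ozero.
  have {e0} -> : e = ozero by apply/le_anti; rewrite e0 ozero_le.
  by elim: k => //= k ->; rewrite hsum0.
rewrite omega_exp_succ0; apply: orec_ge => _ v; rewrite osucc_le => v0.
by rewrite -{1}(omul1 v) omul_ltE.
Qed.

End Ordinals.

Section OrderedGroups.
Local Open Scope order_scope.
Variable G : oagType.
Implicit Types (a b x y z : G) (A B X Y : set G) (o : ord).

(** * Order and finite sums in an ordered abelian group *)

Lemma oag_ltNge x y : (x < y) = ~~ (y <= x).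
Proof. by apply: comparable_ltNge; rewrite /Order.comparable oag_le_total. Qed.

Lemma oag_leNgt x y : (x <= y) = ~~ (y < x).
Proof. by rewrite oag_ltNge negbK. Qed.

Lemma oag_leD x y a b : x <= y -> a <= b -> x + a <= y + b.
Proof.
move=> xy ab; apply: (@le_trans _ _ (y + a)); first exact: oag_leD2r.
by rewrite ![y + _]addrC; apply: oag_leD2r.
Qed.

Lemma oag_ltD2r z x y : x < y -> x + z < y + z.
Proof.
rewrite !oag_ltNge; apply: contra => h.
by have := oag_leD2r (- z) _ _ h; rewrite !addrK.
Qed.

Lemma oag_leMn n a b : a <= b -> a *+ n <= b *+ n.
Proof. by move=> ab; elim: n => // n IH; rewrite !mulrS; apply: oag_leD. Qed.

Lemma oag_leMn2r a m n : 0 < a -> (a *+ m <= a *+ n) = (m <= n)%N.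
Proof.
move=> a0; have H k : 0 <= a *+ k.
  by elim: k => // k IH; rewrite mulrS -[0]addr0 oag_leD // ltW.
apply/idP/idP => [|mn]; last first.
  by rewrite -(subnK mn) mulrnDr -{1}[a *+ m]add0r; apply: oag_leD2r.
apply: contraTT; rewrite -ltnNge -oag_ltNge => nm.
rewrite -(subnK nm) mulrnDr mulrS addrA -{1}[a *+ n]add0r; apply: oag_ltD2r.
apply: (lt_le_trans a0); rewrite -{1}[a]add0r; exact: oag_leD2r.
Qed.

Lemma oag_abs_pos a : 0 < a -> oag_abs a = a.
Proof.
move=> a0; rewrite /oag_abs /Order.max; case: ifP => // /(lt_trans a0).
by move=> /(oag_ltD2r a); rewrite add0r addNr => /(lt_trans a0); rewrite ltxx.
Qed.

Lemma sum_ge0 (s : seq G) : (forall a, a \in s -> 0 < a) -> 0 <= \sum_(a <- s) a.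
Proof.
elim: s => [|a s IH] sp; first by rewrite big_nil.
rewrite big_cons -[X in X <= _]addr0; apply: oag_leD; first exact/ltW/sp/mem_head.
by apply: IH => b bs; rewrite sp // inE bs orbT.
Qed.

Lemma le_sum_mem (s : seq G) b : (forall a, a \in s -> 0 < a) -> b \in s ->
  b <= \sum_(a <- s) a.
Proof.
move=> sp /perm_to_rem/(perm_big _) ->; rewrite big_cons -{1}[b]addr0.
by apply: oag_leD => //; apply: sum_ge0 => a /mem_rem/sp.
Qed.

Lemma sum_ge_mul (s : seq G) b : (forall a, a \in s -> b <= a) ->
  b *+ size s <= \sum_(a <- s) a.
Proof.
elim: s => [|a s IH] sb; first by rewrite big_nil.
rewrite big_cons mulrS oag_leD ?sb ?mem_head // IH // => c cs.
by rewrite sb // inE cs orbT.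
Qed.

Lemma sum_le_mul (s : seq G) b : (forall a, a \in s -> a <= b) ->
  \sum_(a <- s) a <= b *+ size s.
Proof.
elim: s => [|a s IH] sb; first by rewrite big_nil.
rewrite big_cons mulrS oag_leD ?sb ?mem_head // IH // => c cs.
by rewrite sb // inE cs orbT.
Qed.

Lemma seq_max (s : seq G) : s <> [::] -> exists2 b, b \in s & forall a, a \in s -> a <= b.
Proof.
elim: s => // c [|d s] IH _.
  by exists c => [|a]; rewrite inE // => /eqP ->.
have [//|b bs bmax] := IH; have [cb|bc] := orP (oag_le_total c b).
  exists b => [|a]; first by rewrite inE bs orbT.
  by rewrite inE => /predU1P[->//|/bmax].
exists c => [|a]; first by rewrite mem_head.
by rewrite inE => /predU1P[->//|/bmax ab]; apply: le_trans bc.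
Qed.

(** * Embeddings of sets into ordinals *)

(* A strictly increasing map into [o]: for a linear order this says at once
   that [X] is well ordered and that its order type is at most [o]. *)
Definition embeds X o : Prop := exists f : G -> ord,
  (forall x, X x -> f x < o) /\
  (forall x y, X x -> X y -> x < y -> f x < f y).

Lemma embeds_sub X Y o o' : X `<=` Y -> o <= o' -> embeds Y o -> embeds X o'.
Proof.
move=> XY oo' [f [f1 f2]]; exists f; split=> [x /XY/f1 h|x y /XY Yx /XY].
  exact: lt_le_trans oo'.
exact: f2.
Qed.

Lemma embeds_wo X o : embeds X o -> wo_chain (T := G) <=%R [in X].
Proof.
move=> [f [_ f2]] C CX [x Cx].
have [|[z Cz fz] zmin] := @ominP [set f y | y in [set y | y \in C]].
  by exists (f x), x.
have zle y : y \in C -> z <= y.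
  move=> Cy; rewrite oag_leNgt; apply/negP => yz.
  have := f2 y z; have := CX y Cy; have := CX z Cz; rewrite !inE => Xz Xy.
  move=> /(_ Xy Xz yz); rewrite fz ltNge => /negP; apply; apply: zmin.
  by exists y.
exists z; split=> [|y [Cy ymin]]; first by split.
by apply/le_anti; rewrite zle // ymin.
Qed.

Lemma embeds_otype X o : embeds X o -> otype (T := G) <=%R X <= o.
Proof.
move=> Xo; have [g [[gt g_inj g_surj] g_mono]] := oag_otypeP (embeds_wo _ _ Xo).
have [f [f1 f2]] := Xo.
(* The enumeration [g] is pointwise least: if [f x < g x], then [f x = g y] for some [y < x], and
   [f y < f x = g y] contradicts induction. *)
have H x : X x -> g x <= f x.
  move Ep : (g x) => v; elim/ord_ind: v x Ep => v IH x Ep Xx.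
  rewrite leNgt; apply/negP => fv.
  have vt : v < otype (T := G) <=%R X by rewrite -Ep; apply: gt.
  have [y Xy gy] := g_surj (f x) (lt_trans fv vt).
  have yx : y < x by rewrite oag_ltNge -g_mono ?inE // -ltNge Ep gy.
  by have := IH _ fv y gy Xy; rewrite leNgt f2.
rewrite leNgt; apply/negP => ot; have [x Xx gx] := g_surj o ot.
by have := H x Xx; rewrite gx leNgt f1.
Qed.

Lemma embeds_segment X o x : embeds X o -> X x ->
  exists2 o', o' < o & embeds (X `&` [set y | y < x]) o'.
Proof.
move=> [f [f1 f2]] Xx; exists (f x); first exact: f1.
by exists f; split=> [y [Xy yx]|y z [Xy _] [Xz _]]; apply: f2.
Qed.

(** Ranking each [x] by the least ordinal that receives the segment below it glues the local
    embeddings, however unrelated these are. *)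
Lemma embeds_local_lt X o :
  (forall x, X x -> exists2 o', o' < o & embeds (X `&` [set y | y < x]) o') ->
  embeds X o.
Proof.
move=> loc; pose S x := [set o' | embeds (X `&` [set y | y < x]) o'].
have S0 x : X x -> S x !=set0 by move=> /loc[o' _ h]; exists o'.
exists (fun x => omin (S x)); split=> [x Xx|x y Xx Xy xy].
  have [o' oo' h] := loc x Xx; apply: le_lt_trans oo'.
  exact: (ominP (S0 x Xx)).2.
(* An optimal embedding [f] of the segment below [y] sends the segment below [x] into [f x], which
   is less than the rank of [y]. *)
have [[f [f1 f2]] _] := ominP (S0 y Xy).
apply: (@le_lt_trans _ _ (f x)); last exact: f1.
apply: (ominP (S0 x Xx)).2; exists f; split=> [z [Xz zx]|z t [Xz zx] [Xt tx]].
  by apply: f2 => //; split=> //; apply: lt_trans xy.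
by apply: f2; split=> //; apply: lt_trans xy.
Qed.

Lemma embeds_local X o : (forall x, X x -> embeds (X `&` [set y | y <= x]) o) ->
  embeds X o.
Proof.
move=> loc; apply: embeds_local_lt => x Xx; have [|o' oo' h] := embeds_segment _ _ x (loc x Xx).
  by split=> //=.
exists o' => //; apply: embeds_sub h => // y [Xy yx]; split=> //; split=> //.
exact: ltW.
Qed.

(** Below a point [x] of [X], the union lies in [X_{<x}] and [Y]. Induction bounds this by a natural
    sum with a smaller left term, and strict monotonicity concludes; points of [Y] are symmetric. *)
Lemma embeds_union X Y o o' : embeds X o -> embeds Y o' ->
  embeds (X `|` Y) (hsum o o').
Proof.
elim/ord_ind: o o' X Y => o IHo o'; elim/ord_ind: o' => o' IHo' X Y Xo Yo'.
apply: embeds_local_lt => z [Xz|Yz].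
  have [p po Xp] := embeds_segment _ _ _ Xo Xz.
  exists (hsum p o'); first exact: hsum_ltl.
  apply: embeds_sub (IHo _ po _ _ _ Xp Yo') => // y [[Xy|Yy] yz]; first by left.
  by right.
have [p po Yp] := embeds_segment _ _ _ Yo' Yz.
exists (hsum o p); first exact: hsum_ltr.
apply: embeds_sub (IHo' _ po _ _ Xo Yp) => // y [[Xy|Yy] yz]; first by left.
by right.
Qed.

Lemma embeds_split X o o' : embeds X (oadd o o') -> exists Y Z : set G,
  [/\ X = Y `|` Z, embeds Y o & embeds Z o'].
Proof.
move=> [f [f1 f2]].
exists (X `&` [set x | f x < o]), (X `&` [set x | o <= f x]); split.
- apply/seteqP; split=> [x Xx|x [|] [] //].
  by have [fo|of'] := ltP (f x) o; [left|right].
- by exists f; split=> [x []//|x y [Xx _] [Xy _]]; apply: f2.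
(* Left subtraction of [o] from [f]. *)
- pose g x := omin [set p | oadd o p = f x].
  have gE x : o <= f x -> oadd o (g x) = f x.
    by move=> /osub_ex[p pE]; apply: (@ominP [set p | oadd o p = f x] _).1; exists p.
  exists g; split=> [x [Xx /gE h]|x y [Xx /gE hx] [Xy /gE hy] xy].
    by rewrite -(oadd_ltE o) h f1.
  by rewrite -(oadd_ltE o) hx hy f2.
Qed.

Lemma embeds_sumset A B o o' : embeds A o -> embeds B o' ->
  embeds [set a + b | a in A & b in B] (hprod o o').
Proof.
elim/ord_ind: o o' A B => o IHo o'; elim/ord_ind: o' => o' IHo' A B Ao Bo'.
have [o0|[e oE]|[p [q [po qo pq pq']]]] := ord_split o.
- apply: embeds_local_lt => z [a Aa [b Bb _]].
  by have [f [/(_ a Aa)]] := Ao; rewrite o0 ltNge ozero_le.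
- have [o0|[f oE']|[p [q [po qo pq pq']]]] := ord_split o'.
  + apply: embeds_local_lt => z [a Aa [b Bb _]].
    by have [f [/(_ b Bb)]] := Bo'; rewrite o0 ltNge ozero_le.
  + apply: embeds_local_lt => _ [a Aa [b Bb <-]].
    have [p po Ap] := embeds_segment _ _ _ Ao Aa.
    have [q qo Bq] := embeds_segment _ _ _ Bo' Bb.
    exists (hsum (hprod p o') (hprod o q)).
      rewrite oE oE' hprod_omega_exp; apply: hsum_lt_omega_exp.
        by apply: hprod_lt_omega_exp; rewrite -oE.
      by rewrite hprod_comm hsumC; apply: hprod_lt_omega_exp; rewrite -oE'.
    apply: embeds_sub (embeds_union _ _ _ _ (IHo _ po _ _ _ Ap Bo') (IHo' _ qo _ _ Ao Bq)) => //.
    move=> _ [[a' Aa' [b' Bb' <-]] /= lt].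
    (* If neither [a' < a] nor [b' < b], then [a + b <= a' + b']. *)
    have [a'a|aa'] := boolP (a' < a); first by left; exists a' => //; exists b'.
    right; exists a' => //; exists b' => //; split=> //=; rewrite oag_ltNge.
    apply: contraTN lt => bb'; rewrite -oag_leNgt oag_leD // oag_leNgt //.
  + have [Y [Z [BE Yp Zq]]] : exists Y Z, [/\ B = Y `|` Z, embeds Y p & embeds Z q].
      by apply: embeds_split; rewrite pq.
    (* Distributivity matches the decomposition of [B] with the bound for unions. *)
    rewrite -pq' hprod_comm hprod_hsuml 2!(hprod_comm _ o).
    apply: embeds_sub (embeds_union _ _ _ _ (IHo' _ po _ _ Ao Yp) (IHo' _ qo _ _ Ao Zq)) => //.
    move=> z [a Aa [b]]; rewrite BE => -[Yb|Zb] <-; [left|right]; exists a => //; by exists b.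
- have [Y [Z [AE Yp Zq]]] : exists Y Z, [/\ A = Y `|` Z, embeds Y p & embeds Z q].
    by apply: embeds_split; rewrite pq.
  rewrite -pq' hprod_hsuml.
  apply: embeds_sub (embeds_union _ _ _ _ (IHo _ po _ _ _ Yp Bo') (IHo _ qo _ _ _ Zq Bo')) => //.
  move=> z [a]; rewrite AE => -[Ya|Za] [b Bb <-]; [left|right]; exists a => //; by exists b.
Qed.

(** * Finite sums, one archimedean class at a time *)

Definition sums0 A : set G := [set x | exists s : seq G,
  (forall a, a \in s -> A a) /\ x = \sum_(a <- s) a].

Definition sums_le A k : set G := [set x | exists s : seq G,
  [/\ (size s <= k)%N, (forall a, a \in s -> A a) & x = \sum_(a <- s) a]].

Lemma embeds_zero : embeds [set 0] (osucc ozero).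
Proof.
exists (fun=> ozero); split=> [x _|x y -> ->]; first exact: osucc_gt.
by rewrite ltxx.
Qed.

(** Padding with zeros makes a sum of at most [k] terms a sum of exactly [k] terms from [A] with 0
    adjoined; the adjoined 0 accounts for the added [osucc ozero]. *)
Lemma embeds_sums_le A o k : embeds A o ->
  embeds (sums_le A k) (hexpn (hsum o (osucc ozero)) k).
Proof.
move=> Ao; elim: k => [|k IH].
  apply: embeds_sub embeds_zero => // x [s [s0 _ ->]]; move: s0.
  by rewrite leqn0 size_eq0 => /eqP ->; rewrite big_nil.
apply: embeds_sub (embeds_sumset _ _ _ _ (embeds_union _ _ _ _ Ao embeds_zero) IH) => //.
move=> x [[|a s] [sk sA ->]].
  exists 0; first by right.
  by exists 0; [exists [::]; split=> //|]; rewrite big_nil ?addr0.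
exists a; first by left; apply: sA; rewrite mem_head.
exists (\sum_(b <- s) b); last by rewrite big_cons.
by exists s; split=> // b bs; apply: sA; rewrite inE bs orbT.
Qed.

Lemma embeds_sums0_empty A : (forall a, ~ A a) -> embeds (sums0 A) (osucc ozero).
Proof.
move=> A0; apply: embeds_sub embeds_zero => // _ [[|a s] [sA ->]].
  by rewrite big_nil.
by case: (A0 a); apply: sA; rewrite mem_head.
Qed.

Lemma embeds_min A o : embeds A o -> A !=set0 -> exists2 a, A a & forall b, A b -> a <= b.
Proof.
move=> [f [f1 f2]] [b Ab].
have [|[a Aa fa] amin] := @ominP [set f y | y in A]; first by exists (f b), b.
exists a => // c Ac; rewrite oag_leNgt; apply/negP => /(f2 c a Ac Aa).
by rewrite fa ltNge => /negP; apply; apply: amin; exists c.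
Qed.

Lemma embeds_one_class A o : (forall a, A a -> 0 < a) -> onat 2 <= o -> embeds A o ->
  (forall a b, A a -> A b -> arch_le a b) -> embeds (sums0 A) (oexp o oomega).
Proof.
move=> Apos o2 Ao Aarch; have o1 : osucc ozero < o by rewrite -osucc_le.
(* [A] may be empty: the induction in [embeds_sums0] also meets ranks that no element attains. *)
have [[a0 Aa0]|A0] := pselect (A !=set0); last first.
  apply: embeds_sub (embeds_sums0_empty A _) => //; first by rewrite osucc_le oexp_gt0.
  by move=> a Aa; apply: A0; exists a.
have [{Aa0}a Aa amin] := embeds_min _ _ Ao (ex_intro _ a0 Aa0).
apply: embeds_local => _ [s [sA ->]].
have [N sN] : exists N, \sum_(b <- s) b <= a *+ N.
  elim: s sA => [_|b s IH sA]; first by exists 0%N; rewrite big_nil.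
  have [c cs|N sN] := IH; first by apply: sA; rewrite inE cs orbT.
  have Ab : A b by apply: sA; rewrite mem_head.
  have [n] := Aarch b a Ab Aa; rewrite !oag_abs_pos ?Apos // => bn.
  by exists (n + N)%N; rewrite big_cons mulrnDr oag_leD.
(* All terms are at least [a], so a sum that is at most [a *+ N] has at most [N] terms. *)
apply: embeds_sub (hexpn_le_oexp _ N o2) (embeds_sums_le _ _ N Ao) => y [[t [tA ->]] ty].
exists t; split=> //; rewrite -(oag_leMn2r a) ?Apos //.
apply: le_trans (le_trans ty sN); apply: sum_ge_mul => b /tA; exact: amin.
Qed.

(** [c] ranks elements by archimedean class. As [o] is merely an upper bound for the type of [A], it
    stays fixed while the induction on [b] passes to subsets. *)
Lemma embeds_sums0 A o (b : ord) (c : G -> ord) :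
  (forall a, A a -> 0 < a) -> onat 2 <= o -> embeds A o ->
  (forall a, A a -> c a < b) ->
  (forall a a', A a -> A a' -> c a <= c a' <-> arch_le a a') ->
  embeds (sums0 A) (hexp (oexp o oomega) b).
Proof.
move=> + o2; elim/ord_ind: b A => b IH A Apos Ao cb carch.
have [b0|[b' bE]|bl] := ord_case b.
- rewrite b0 /hexp /bighprod orec0; apply: embeds_sums0_empty => a /cb.
  by rewrite b0 ltNge ozero_le.
- rewrite bE /hexp /bighprod orecS -/(bighprod _ _) -/(hexp _ _).
  pose A1 := A `&` [set a | c a < b']; pose A2 := A `&` [set a | c a = b'].
  have E1 : embeds (sums0 A1) (hexp (oexp o oomega) b').
    apply: IH => [|a []||a []//|a a' [Aa _] [Aa' _]]; last exact: carch.
    - by rewrite bE osucc_gt.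
    - by move/Apos.
    - by apply: embeds_sub Ao => // a [].
  have E2 : embeds (sums0 A2) (oexp o oomega).
    apply: embeds_one_class => // [a [/Apos]//||a a' [Aa ca] [Aa' ca']].
      by apply: embeds_sub Ao => // a [].
    by apply/carch => //; rewrite ca ca'.
  apply: embeds_sub (embeds_sumset _ _ _ _ E1 E2) => // _ [s [sA ->]].
  (* Separate the terms of rank below [b'] from those of top rank. Either part may be empty, which
     is why [sums0] admits the empty sum. *)
  exists (\sum_(a <- s | c a < b') a).
    exists [seq a <- s | c a < b']; split; last by rewrite big_filter.
    by move=> a; rewrite mem_filter => /andP[ca /sA Aa].
  exists (\sum_(a <- s | ~~ (c a < b')) a); last by rewrite [RHS](bigID (fun a => c a < b')).
  exists [seq a <- s | ~~ (c a < b')]; split; last by rewrite big_filter.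
  move=> a; rewrite mem_filter -leNgt => /andP[ca /sA Aa]; split=> //=.
  by apply/le_anti; rewrite ca -ltoS -bE cb.
- apply: embeds_local => _ [s [sA ->]].
  have [m mb mP] : exists2 m, m < b & forall t, (forall a, a \in t -> A a) ->
      \sum_(a <- t) a <= \sum_(a <- s) a -> forall a, a \in t -> c a <= m.
    (* For empty [s], positivity leaves no term in [t], so any rank below [b] serves; otherwise [m]
       is the rank of the greatest term of [s]. *)
    have [->|/eqP s0] := eqVneq s [::].
      exists ozero => [|t tA]; first by rewrite lt_neqAle ozero_le andbT eq_sym; apply/eqP/bl.1.
      rewrite big_nil => t0 a at'; have := Apos a (tA a at'); rewrite oag_ltNge.
      by rewrite (le_trans _ t0) // le_sum_mem // => d /tA/Apos.
    have [d ds dmax] := seq_max _ s0; exists (c d); first exact/cb/sA.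
    move=> t tA ts a at'; apply/carch; [exact: tA|exact: sA|].
    (* A term of [t] is at most the sum of [s], hence at most [size s] times the greatest term
       [d]. *)
    exists (size s); rewrite !oag_abs_pos; [|exact/Apos/sA|exact/Apos/tA].
    apply: le_trans (sum_le_mul _ _ dmax); apply: le_trans ts.
    by apply: le_sum_mem => // e /tA/Apos.
  (* Ranks up to [m] are those below [osucc m], which is still below the limit [b]. *)
  pose A1 := A `&` [set a | c a < osucc m]; have Smb := olimit_ltS bl mb.
  have E1 : embeds (sums0 A1) (hexp (oexp o oomega) (osucc m)).
    apply: IH => [//|a []||a []//|a a' [Aa _] [Aa' _]]; last exact: carch.
    - by move/Apos.
    - by apply: embeds_sub Ao => // a [].
  apply: embeds_sub E1; last exact: orec_lim_ge.
  move=> _ [[t [tA ->]] ts]; exists t; split=> // a at'; split; first exact: tA.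
  by rewrite /= ltoS; apply: mP at'.
Qed.

(** * The order on archimedean classes and the conclusion *)

Lemma arch_le_refl a : arch_le a a.
Proof. by exists 1%N. Qed.

Lemma arch_le_trans a b d : arch_le a b -> arch_le b d -> arch_le a d.
Proof.
move=> [m ab] [n bd]; exists (n * m)%N; apply: le_trans ab _.
by rewrite mulrnA; apply: oag_leMn.
Qed.

(** Transitivity makes the comparison of classes independent of the representatives. *)
Lemma arch_class_leE a b : arch_class_le (arch_class a) (arch_class b) <-> arch_le a b.
Proof.
split=> [/asboolP[x [y [[ax xa] [by' yb] xy]]]|ab].
  exact: arch_le_trans ax (arch_le_trans _ _ _ xy yb).
by apply/asboolP; exists a, b; split=> //; split; apply: arch_le_refl.
Qed.

Lemma arch_class_eq a b : arch_le a b -> arch_le b a -> arch_class a = arch_class b.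
Proof.
move=> ab ba; apply/seteqP; split=> x [] /= h1 h2; split.
- exact: arch_le_trans ba h1.
- exact: arch_le_trans h2 ab.
- exact: arch_le_trans ab h1.
- exact: arch_le_trans h2 ba.
Qed.

(** On positive elements [a <= b] gives [arch_le a b] with factor 1, so the least element of [A]
    with class in [C] has the least class in [C]. *)
Lemma arch_class_wo A : (forall a, A a -> 0 < a) ->
  wo_chain (T := G) <=%R [in A] ->
  wo_chain (@arch_class_le G) [in @arch_class G @` A].
Proof.
move=> Apos Awo C CA [D CD].
have : D \in [set arch_class a | a in A] by exact: CA.
rewrite inE => -[a Aa aD].
have [||b [[]]] := Awo [pred x | `[< A x >] && (arch_class x \in C)].
- by move=> x /andP[/asboolP Ax _]; rewrite !inE.
- by exists a; rewrite inE aD CD andbT; apply/asboolP.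
rewrite inE => /andP[/asboolP Ab Cb] bmin _.
have bP E : E \in C -> arch_class_le (arch_class b) E.
  move=> CE; have : E \in [set arch_class a | a in A] by exact: CA.
  rewrite inE => -[x Ax xE]; rewrite -xE; apply/arch_class_leE; exists 1%N.
  rewrite !oag_abs_pos ?Apos //; apply: bmin; rewrite inE xE CE andbT.
  exact/asboolP.
exists (arch_class b); split=> [|E [CE Emin]]; first by split.
have : E \in [set arch_class a | a in A] by exact: CA.
rewrite inE => -[x Ax xE]; rewrite -xE; apply: arch_class_eq.
  by apply/arch_class_leE; rewrite xE; apply: bP.
by apply/arch_class_leE; rewrite xE; apply: Emin.
Qed.

End OrderedGroups.

Theorem mainTheorem4 (G : oagType) (A : set G) (alpha beta : ord)
    (A_gt0 : forall a : G, A a -> 0 < a)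
    (A_wo : wo_chain (T := G) <=%R [in A])
    (alphaE : alpha = otype (T := G) <=%R A)
    (alpha_ge2 : (onat 2 <= alpha)%O)
    (betaE : beta = otype (@arch_class_le G) (@arch_class G @` A)) :
  wo_chain (T := G) <=%R [in finite_sums A] /\
  (otype (T := G) <=%R (finite_sums A) <= hexp (oexp alpha oomega) beta)%O.
Proof.
suff H : embeds G (finite_sums A) (hexp (oexp alpha oomega) beta).
  by split; [exact: embeds_wo H|exact: embeds_otype].
have [f [[f1 _ _] f_mono]] := oag_otypeP A_wo.
have [g [[g1 _ _] g_mono]] := oag_arch_otypeP (arch_class_wo _ _ A_gt0 A_wo).
apply: (@embeds_sub _ _ (sums0 G A) _ _ _ (lexx _)).
  by move=> x [s [_ sA ->]]; exists s.
(* The rank of an element is the position of its class in the enumeration [g] of all classes met by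
   [A]. *)
apply: (embeds_sums0 _ _ _ _ (fun a => g (arch_class a))) => //.
- exists f; split=> [a Aa|a b Aa Ab ab]; first by rewrite alphaE; apply: f1.
  by rewrite ltNge f_mono ?inE // -oag_ltNge.
- by move=> a Aa; rewrite betaE; apply: g1; exists a.
- move=> a b Aa Ab; rewrite g_mono; [exact: arch_class_leE| |]; rewrite inE.
    by exists a.
  by exists b.
Qed.
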